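(* Let $(\Theta,g_\theta)$ be a Wasserstein statistical manifold, with $\Theta\subset\mathbb{R}^d$ and $g_\theta(\xi,\eta)=\xi^TG_W(\theta)\eta$, where $G_W(\theta)\in\mathbb{R}^{d\times d}$ is symmetric positive definite. Let $R\in C^1(\Theta)$. Then the gradient flow $\frac{d\theta}{dt}=-\nabla_gR(\theta)$ of $R$ in $(\Theta,g_\theta)$ satisfies $$\frac{d\theta}{dt}=-G_W(\theta)^{-1}\nabla_\theta R(\theta).$$
   Context: Let $\Omega$ be a compact domain in $\mathbb{R}^n$ or $\Omega=\mathbb{R}^n$, let $\Theta\subset\mathbb{R}^d$ be a parameter space, and let $\theta\mapsto\rho(\cdot,\theta)$ be a smooth family of positive smooth probability densities on $\Omega$. For a tangent vector $\xi\in T_\theta\Theta$, let $d_\xi\rho(\cdot,\theta)$ be the derivative of $\theta\mapsto\rho(\cdot,\theta)$ in direction $\xi$, and let $\Phi_\xi$ be a smooth solution of $-\nabla\cdot(\rho(x,\theta)\nabla\Phi_\xi(x))=d_\xi\rho(x,\theta)$ (assumed to exist), with $\partial\Phi_\xi/\partial n=0$ on $\partial\Omega$ and $\int_\Omega\rho\|\nabla\Phi_\xi\|^2dx<\infty$ if $\Omega$ is compact, or with $\int\rho\|\nabla\Phi_\xi\|^2dx<\infty$ and $\int\rho|\Phi_\xi|^2dx<\infty$ if $\Omega=\mathbb{R}^n$. The $L^2$-Wasserstein metric tensor on $\Theta$ is $g_\theta(\xi,\eta)=\int_\Omega\rho(x,\theta)\nabla\Phi_\xi(x)\cdot\nabla\Phi_\eta(x)\,dx$.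 When $g_\theta$ is positive definite (non-degenerate model), $(\Theta,g_\theta)$ is called the Wasserstein statistical manifold, and $G_W(\theta)$ denotes the matrix of $g_\theta$. The Riemannian gradient $\nabla_gR(\theta)\in T_\theta\Theta$ is defined by $g_\theta(\nabla_gR(\theta),\xi)=\nabla_\theta R(\theta)\cdot\xi$ for all $\xi\in T_\theta\Theta$, where $\nabla_\theta$ is the Euclidean gradient. *)

(* Defs.v *)
From HB Require Import structures.
From mathcomp Require Import all_boot all_order all_algebra.
From mathcomp Require Import all_classical all_reals all_analysis.

Set Implicit Arguments.
Unset Strict Implicit.
Unset Printing Implicit Defensive.

Import Order.TTheory GRing.Theory Num.Theory.
Import numFieldNormedType.Exports.

Local Open Scope classical_set_scope.
Local Open Scope ring_scope.

Lemma product_sigma_finite d1 d2 (T1 : measurableType d1)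
    (T2 : measurableType d2) (R : realType)
    (m1 : {sigma_finite_measure set T1 -> \bar R})
    (m2 : {sigma_finite_measure set T2 -> \bar R}) :
  sigma_finite setT (m1 \x m2)%E.
Proof.
have /sigma_finiteP[F [TF ndF Foo]] := sigma_finiteT m1.
have /sigma_finiteP[G [TG ndG Goo]] := sigma_finiteT m2.
exists (fun n => F n `*` G n).
  rewrite -setXTT TF TG predeqE => -[x y]; split.
    move=> [/= [n _ Fnx] [k _ Gky]]; exists (maxn n k) => //; split.
    - by move: x Fnx; exact/subsetPset/ndF/leq_maxl.
    - by move: y Gky; exact/subsetPset/ndG/leq_maxr.
  by move=> [n _ []/= ? ?]; split; exists n.
move=> k; have [? ?] := Foo k; have [? ?] := Goo k.
split; first exact: measurableX.
by rewrite product_measure1E// lte_mul_pinfty// ge0_fin_numE.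
Qed.

Section lebesgue_Rn.
Context (R : realType).
Local Notation TR := (measurableTypeR R).

Definition cons_pair n (p : TR * n.-tuple TR) : n.+1.-tuple TR :=
  [tuple of p.1 :: p.2].

Definition uncons_pair n (t : n.+1.-tuple TR) : TR * n.-tuple TR :=
  (thead t, [tuple of behead t]).

Lemma cons_pairK n : cancel (@cons_pair n) (@uncons_pair n).
Proof. by move=> [x t]; congr pair; apply: val_inj. Qed.

Lemma measurable_cons_pair n : measurable_fun setT (@cons_pair n).
Proof.
by apply: measurable_cons; [exact: measurable_fst|exact: measurable_snd].
Qed.

Lemma measurable_uncons_pair n : measurable_fun setT (@uncons_pair n).
Proof.
apply/measurable_fun_pairP; split; first exact: measurable_tnth.
exact: measurable_behead.
Qed.

Section step.
Variables (n : nat) (mu : {sigma_finite_measure set (n.-tuple TR) -> \bar R}).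

Definition lebesgue_step : set (n.+1.-tuple TR) -> \bar R :=
  pushforward (@lebesgue_measure R \x mu)%E (@cons_pair n).

Let lebesgue_step0 : lebesgue_step set0 = 0%E.
Proof. by rewrite /lebesgue_step /pushforward preimage_set0 measure0. Qed.

Let lebesgue_step_ge0 A : (0 <= lebesgue_step A)%E.
Proof. exact: (measure_ge0 (@lebesgue_measure R \x mu)%E). Qed.

Let lebesgue_step_sigma_additive : semi_sigma_additive lebesgue_step.
Proof.
have mpre A : measurable A -> measurable (@cons_pair n @^-1` A).
  by move=> mA; rewrite -[X in measurable X]setTI; exact: measurable_cons_pair.
move=> F mF tF mUF; rewrite /lebesgue_step /pushforward preimage_bigcup.
apply: (@measure_semi_sigma_additive _ _ _ (@lebesgue_measure R \x mu)%E).
- by move=> k; exact: mpre.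
- apply/trivIsetP => i j _ _ ij; rewrite -preimage_setI.
  by move/trivIsetP : tF => /(_ _ _ _ _ ij) ->//; rewrite preimage_set0.
- by rewrite -preimage_bigcup; exact: mpre.
Qed.

HB.instance Definition _ := isMeasure.Build _ _ _ lebesgue_step
  lebesgue_step0 lebesgue_step_ge0 lebesgue_step_sigma_additive.

Let lebesgue_step_sigma_finite : sigma_finite setT lebesgue_step.
Proof.
have [F FT Foo] : sigma_finite setT (@lebesgue_measure R \x mu)%E.
  exact: product_sigma_finite.
exists (fun k => @uncons_pair n @^-1` F k).
  by rewrite -preimage_bigcup -FT preimage_setT.
move=> k; have [mF Fk] := Foo k; split.
  by rewrite -[X in measurable X]setTI; exact: measurable_uncons_pair.
rewrite /lebesgue_step /pushforward -comp_preimage.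
by rewrite (_ : _ \o _ = id) //; apply/funext => p /=; rewrite cons_pairK.
Qed.

HB.instance Definition _ := Measure_isSigmaFinite.Build _ _ _ lebesgue_step
  lebesgue_step_sigma_finite.

End step.

(* The [n]-fold product of the Lebesgue measure on the line. *)
Fixpoint lebesgue_tuple n :
    {sigma_finite_measure set (n.-tuple TR) -> \bar R} :=
  match n with
  | 0 => \d_([tuple] : 0.-tuple TR)
  | k.+1 => lebesgue_step (lebesgue_tuple k)
  end.

Lemma lebesgue_tuple_box n (A : 'I_n -> set TR) :
  (forall i, measurable (A i)) ->
  lebesgue_tuple n [set t | forall i, A i (tnth t i)] =
  (\prod_(i < n) @lebesgue_measure R (A i))%E.
Proof.
elim: n A => [|n IHn] A mA.
  by rewrite big_ord0 /= diracE mem_set// => -[].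
rewrite big_ord_recl -IHn//.
have mB : measurable [set t : n.-tuple TR |
                      forall i, A (lift ord0 i) (tnth t i)].
  rewrite (_ : mkset _ =
    \bigcap_(i in [set: 'I_n]) (@tnth n TR ^~ i @^-1` A (lift ord0 i))).
    apply: fin_bigcap_measurable; first exact: finite_finset.
    by move=> i _; rewrite -[X in measurable X]setTI; exact: measurable_tnth.
  by apply/seteqP; split => t /= h i => [_|]; exact: h.
rewrite -product_measure1E//=; congr product_measure1.
apply/seteqP; split => -[x t] /=.
  move=> h; split; first exact: (h ord0).
  by move=> i; have := h (lift ord0 i); rewrite tnthS.
by move=> [h0 hS] i; have [j ->|->] := unliftP ord0 i; rewrite ?tnthS//; apply: hS.
Qed.

End lebesgue_Rn.

(* Integration over a subset of R^n, whose points are column vectors, with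
   respect to Lebesgue measure, through the identification of R^n with
   n-tuples. *)
Section integral_Rn.
Context (R : realType) (n : nat).

Definition cV_of_tuple (t : n.-tuple (measurableTypeR R)) : 'cV[R]_n :=
  \col_i tnth t i.

Definition integral_Rn (Omega : set 'cV[R]_n) (f : 'cV[R]_n -> \bar R) : \bar R :=
  (\int[lebesgue_tuple R n]_(t in cV_of_tuple @^-1` Omega)
     f (cV_of_tuple t))%E.

End integral_Rn.

Section calculus.
Context (R : realType).

(* C^k on an open set U of a finite-dimensional space, via iterated
   directional derivatives. *)
Fixpoint Ck_on (V : normedModType R) (k : nat) (U : set V) (f : V -> R) : Prop :=
  match k with
  | 0 => forall x, U x -> {for x, continuous f}
  | k'.+1 => (forall x, U x -> differentiable f x) /\
             (forall v : V, Ck_on k' U (fun x => 'D_v f x))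
  end.

(* A function on an arbitrary subset A is C^k (resp. smooth) when it is so on
   an open neighbourhood of A; for A open this is C^k (smoothness) on A. *)
Definition Ck_near (V : normedModType R) (k : nat) (A : set V) (f : V -> R) :=
  exists U : set V, [/\ open U, A `<=` U & Ck_on k U f].

Definition smooth_near (V : normedModType R) (A : set V) (f : V -> R) :=
  exists U : set V, [/\ open U, A `<=` U & forall k, Ck_on k U f].

Definition dot n (u v : 'cV[R]_n) : R := \sum_(i < n) u i 0 * v i 0.

Definition gradient n (f : 'cV[R]_n -> R) (x : 'cV[R]_n) : 'cV[R]_n :=
  \col_i 'D_(delta_mx i 0) f x.

Definition divergence n (F : 'cV[R]_n -> 'cV[R]_n) (x : 'cV[R]_n) : R :=
  \sum_(i < n) 'D_(delta_mx i 0) (fun y => F y i 0) x.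

Definition sym_posdef n (G : 'M[R]_n) : Prop :=
  G^T = G /\ forall v : 'cV[R]_n, v != 0 -> 0 < (v^T *m G *m v) 0 0.

Definition compact_domain n (Omega : set 'cV[R]_n) : Prop :=
  compact Omega /\
  exists D : set 'cV[R]_n, [/\ open D, connected D, D !=set0 & Omega = closure D].

(* At a boundary point x of Omega near which Omega is the sublevel set
   {b <= 0} of a C^1 function b with nonzero gradient at x, the outward unit
   normal is the direction of that gradient. *)
Definition outward_unit_normal n (Omega : set 'cV[R]_n) (x nu : 'cV[R]_n) : Prop :=
  (Omega `\` Omega°) x /\ dot nu nu = 1 /\
  exists (b : 'cV[R]_n -> R) (U : set 'cV[R]_n) (c : R),
    [/\ open U, U x, Ck_on 1 U b,
        (forall y, U y -> (Omega y <-> b y <= 0)) &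
        0 < c /\ gradient b x = c *: nu].

End calculus.

Section wasserstein.
Context (R : realType) (n d : nat).
Variables (Omega : set 'cV[R]_n) (Theta : set 'cV[R]_d).
Variable rho : 'cV[R]_n -> 'cV[R]_d -> R.

(* Phi is a potential for the tangent vector xi at theta. The Neumann condition
   is imposed at the boundary points admitting an outward normal; it is void for
   Omega = R^n. *)
Record is_potential (theta xi : 'cV[R]_d) (Phi : 'cV[R]_n -> R) : Prop := {
  potential_smooth : smooth_near Omega Phi;
  potential_eq : forall x, Omega x ->
    - divergence (fun y => rho y theta *: gradient Phi y) x = 'D_xi (rho x) theta;
  potential_neumann : forall x nu, outward_unit_normal Omega x nu ->
    'D_nu Phi x = 0;
  potential_energy :
    (integral_Rn Omega
       (fun x => (rho x theta * dot (gradient Phi x) (gradient Phi x))%:E)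
     < +oo)%E;
  potential_L2 : Omega = setT ->
    (integral_Rn Omega (fun x => (rho x theta * Phi x ^+ 2)%:E) < +oo)%E
}.

(* The tangent space of Theta at each of its points is R^d; Phi theta xi is the
   chosen potential of the tangent vector xi at theta. *)
Variable Phi : 'cV[R]_d -> 'cV[R]_d -> 'cV[R]_n -> R.

Definition wasserstein_metric (theta xi eta : 'cV[R]_d) : R :=
  fine (integral_Rn Omega (fun x =>
    (rho x theta *
     dot (gradient (Phi theta xi) x) (gradient (Phi theta eta) x))%:E)).

Record wasserstein_statistical_manifold : Prop := {
  wsm_domain : compact_domain Omega \/ Omega = setT;
  wsm_smooth : smooth_near (Omega `*` Theta)
    (fun z : 'cV[R]_n * 'cV[R]_d => rho z.1 z.2);
  wsm_pos : forall x theta, Omega x -> Theta theta -> 0 < rho x theta;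
  wsm_prob : forall theta, Theta theta ->
    integral_Rn Omega (fun x => (rho x theta)%:E) = 1%E;
  wsm_potential : forall theta xi, Theta theta ->
    is_potential theta xi (Phi theta xi);
  wsm_nondegenerate : forall theta xi, Theta theta -> xi != 0 ->
    0 < wasserstein_metric theta xi xi
}.

End wasserstein.

Section gradient_flow.
Context (R : realType) (d : nat).
Variable Theta : set 'cV[R]_d.

(* The vector v with g_theta(v, xi) = nabla L(theta) . xi for all xi, for a
   metric tensor g; it exists and is unique as soon as g_theta is a
   nondegenerate bilinear form. *)
Definition riemannian_gradient (g : 'cV[R]_d -> 'cV[R]_d -> 'cV[R]_d -> R)
    (L : 'cV[R]_d -> R) (theta : 'cV[R]_d) : 'cV[R]_d :=
  get [set v | forall xi, g theta v xi = dot (gradient L theta) xi].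

Definition gradient_flow (g : 'cV[R]_d -> 'cV[R]_d -> 'cV[R]_d -> R)
    (L : 'cV[R]_d -> R) (J : interval R) (gamma : R -> 'cV[R]_d) : Prop :=
  forall t, t \in J -> Theta (gamma t) /\
    is_derive t (1 : R) gamma (- riemannian_gradient g L (gamma t)).

End gradient_flow.

(* Main.v *)
Require Import Defs.
From mathcomp Require Import all_boot all_order all_algebra.
From mathcomp Require Import all_classical all_reals all_analysis.

Import Order.TTheory GRing.Theory Num.Theory.
Import numFieldNormedType.Exports.

Local Open Scope classical_set_scope.
Local Open Scope ring_scope.

(** In coordinates, the condition [v^T G xi = (gradient L theta)^T xi] for all [xi] is the linear
    system [G v = gradient L theta], because [G] is symmetric. Positive definiteness makes [G]
    invertible ([sym_posdef_unitmx]), so the Riemannian gradient is the solution of this system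
    ([riemannian_gradientE]). A gradient flow stays in [Theta], so this formula can be substituted
    into its velocity at every time of [J]. *)

Lemma dot_mulmx {R : realType} {d : nat} (u v : 'cV[R]_d) :
  dot u v = (u^T *m v) 0 0.
Proof. by rewrite mxE; apply: eq_bigr => i _; rewrite mxE. Qed.

(** A nonzero row [v] with [v G = 0] would give [v G v^T = 0], against positivity; a square matrix
    with trivial left kernel is invertible. *)
Lemma sym_posdef_unitmx {R : realType} {d : nat} {G : 'M[R]_d} :
  sym_posdef G -> G \in unitmx.
Proof.
move=> [_ Gpos]; rewrite -row_free_unit; apply: inj_row_free => v vG0.
apply/eqP/negPn/negP => v0.
have : v^T != 0 by apply: contra v0 => /eqP vT0; rewrite -[v]trmxK vT0 trmx0.
by move=> /Gpos; rewrite trmxK vG0 mul0mx mxE ltxx.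
Qed.

Lemma riemannian_gradientE {R : realType} {d : nat}
    (g : 'cV[R]_d -> 'cV[R]_d -> 'cV[R]_d -> R) {G : 'M[R]_d}
    (L : 'cV[R]_d -> R) (theta : 'cV[R]_d) :
  sym_posdef G ->
  (forall xi eta, g theta xi eta = (xi^T *m G *m eta) 0 0) ->
  riemannian_gradient g L theta = invmx G *m gradient L theta.
Proof.
move=> Gpd gE; have Gu := sym_posdef_unitmx Gpd; have [GT _] := Gpd.
rewrite /riemannian_gradient; set D := [set v | _].
have DE v : D v <-> G *m v = gradient L theta.
  split => [Dv|Gv xi]; last by rewrite gE dot_mulmx -Gv trmx_mul GT.
  apply: trmx_inj; rewrite trmx_mul GT; apply/rowP => i.
  (* Testing on the [i]-th basis vector reads off the [i]-th entry of
     [v^T G = (gradient L theta)^T]. *)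
  by have := Dv (delta_mx i 0); rewrite gE dot_mulmx -!colE !mxE.
(* [get] returns an element of [D] only if [D] is inhabited; the chosen element then solves the
   system itself, and cancelling [G] identifies it. *)
have /getPex/DE <- : exists v, D v.
  by exists (invmx G *m gradient L theta); apply/DE; rewrite mulKVmx.
by rewrite mulKmx.
Qed.

Theorem proposition4 (R : realType) (n d : nat)
    (Omega : set 'cV[R]_n) (Theta : set 'cV[R]_d)
    (rho : 'cV[R]_n -> 'cV[R]_d -> R)
    (Phi : 'cV[R]_d -> 'cV[R]_d -> 'cV[R]_n -> R)
    (GW : 'cV[R]_d -> 'M[R]_d)
    (L : 'cV[R]_d -> R) (J : interval R) (gamma : R -> 'cV[R]_d) :
  wasserstein_statistical_manifold Omega Theta rho Phi ->
  (forall theta xi eta, Theta theta ->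
     wasserstein_metric Omega rho Phi theta xi eta =
     (xi^T *m GW theta *m eta) 0 0) ->
  (forall theta, Theta theta -> sym_posdef (GW theta)) ->
  Ck_near 1 Theta L ->
  gradient_flow Theta (wasserstein_metric Omega rho Phi) L J gamma ->
  forall t, t \in J ->
    is_derive t (1 : R) gamma
      (- (invmx (GW (gamma t)) *m gradient L (gamma t))).
Proof.
move=> _ gE Gpd _ flow t /flow[Tt].
by rewrite (riemannian_gradientE _ L _ (Gpd _ Tt) (fun xi eta => gE _ xi eta Tt)).
Qed.
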